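(* (Dot reduction.) Let $F_2$ be a closed $GL(2)$ foam with a thin facet carrying two dots, and let $F_1$ and $F_0$ be the foams obtained from $F_2$ by removing one dot, respectively two dots, from that same facet. Then $$\langle F_2\rangle=E_1\langle F_1\rangle-E_2\langle F_0\rangle,\qquad E_1=x_1+x_2,\quad E_2=x_1x_2.$$
   Context: $\mathbf{k}=\mathbb{Z}[\beta_{k,\ell}:k,\ell\ge0,(k,\ell)\ne(0,0)]$; $p(x,y)=1+\sum\beta_{k,\ell}x^ky^\ell$; $p_{12}=p(x_1,x_2)$, $p_{21}=p(x_2,x_1)$. A closed $GL(2)$ foam $F$ is a compact two-dimensional combinatorial CW-complex embedded in $\mathbb{R}^3$ whose only singularities are singular circles, with neighbourhood $\mathbb{S}^1\times$tripod; facets are thin or double, and along each singular circle two thin facets and one double facet meet. Facets are oriented so that at each singular circle the orientation of each adjacent thin facet agrees with that of the double facet across the circle; the circle is oriented by $t$, where $(v,t)$ is an oriented basis coming from a thin facet with $v$ pointing into the double facet. Thin facets may carry dots. A coloring $c$ maps thin facets to $\{1,2\}$ so that the two thin facets at each singular circle have different colors; double facets are colored $\{1,2\}$. $F_i(c)$ is the union of closed facets whose color is or contains $i$; $\chi_i(c)=\chi(F_i(c))$; $F_{12}$ is the union of thin facets; $d_i(c)$ is the number of dots on facets colored $i$; $\theta^+(c)$ is the number of positive singular circles, where a circle is positive if, looking in the direction of its orientation, the first thin facet met counterclockwise starting from the double facet is colored $1$. Evaluation: $\langle F\rangle=\sum_c\langle F,c\rangle$ over all colorings, with $$\langle F,c\rangle=(-1)^{\theta^+(c)+\chi_2(c)/2}\,\frac{x_1^{d_1(c)}x_2^{d_2(c)}p_{12}^{\chi_1(c)/2}p_{21}^{\chi_2(c)/2}}{(x_1-x_2)^{\chi(F_{12})/2}}\in\mathbf{k}\llbracket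 x_1,x_2\rrbracket\Bigl[\tfrac1{x_1-x_2}\Bigr].$$ *)

(* Defs.v *)
From HB Require Import structures.
From mathcomp Require Import all_boot all_order all_algebra generic_quotient.
From mathcomp Require Import finmap monalg.
From mathcomp Require Import boolp reals.
From mathcomp Require Import ring.

Set Implicit Arguments.
Unset Strict Implicit.
Unset Printing Implicit Defensive.

Import Order.TTheory GRing.Theory Num.Theory.
Local Open Scope ring_scope.

Record fps (R : Type) := Fps { fpscoef : nat -> R }.

Section FpsRing.
Variable R : comNzRingType.
Implicit Types f g h : fps R.

HB.instance Definition _ := gen_eqMixin (fps R).
HB.instance Definition _ := gen_choiceMixin (fps R).

Lemma fpsP f g : (forall n, fpscoef f n = fpscoef g n) -> f = g.
Proof. by case: f g => [f] [g] /= fg; congr Fps; apply/funext. Qed.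

Definition fps0 : fps R := Fps (fun=> 0).
Definition fpsopp f : fps R := Fps (fun n => - fpscoef f n).
Definition fpsadd f g : fps R := Fps (fun n => fpscoef f n + fpscoef g n).
Definition fpsC (a : R) : fps R := Fps (fun n => if n == 0%N then a else 0).
Definition fpsX : fps R := Fps (fun n => (n == 1%N)%:R).
Definition fpsmul f g : fps R :=
  Fps (fun n => \sum_(i < n.+1) fpscoef f i * fpscoef g (n - i)).

Fact fpsaddA : associative fpsadd.
Proof. by move=> f g h; apply: fpsP => n /=; rewrite addrA. Qed.
Fact fpsaddC : commutative fpsadd.
Proof. by move=> f g; apply: fpsP => n /=; rewrite addrC. Qed.
Fact fpsadd0 : left_id fps0 fpsadd.
Proof. by move=> f; apply: fpsP => n /=; rewrite add0r. Qed.
Fact fpsaddN : left_inverse fps0 fpsopp fpsadd.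
Proof. by move=> f; apply: fpsP => n /=; rewrite addNr. Qed.

HB.instance Definition _ :=
  GRing.isZmodule.Build (fps R) fpsaddA fpsaddC fpsadd0 fpsaddN.

Let trunc N f : {poly R} := \poly_(i < N) fpscoef f i.

Let coef_trunc N f n : (n < N)%N -> (trunc N f)`_n = fpscoef f n.
Proof. by move=> nN; rewrite coef_poly nN. Qed.

Let fpsmul_trunc N f g n : (n < N)%N ->
  fpscoef (fpsmul f g) n = (trunc N f * trunc N g)`_n.
Proof.
move=> nN; rewrite coefM; apply: eq_bigr => i _.
by rewrite !coef_trunc // (leq_ltn_trans _ nN) ?leq_subr // -ltnS.
Qed.

Fact fpsmulC : commutative fpsmul.
Proof.
by move=> f g; apply: fpsP => n; rewrite !(@fpsmul_trunc n.+1) // mulrC.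
Qed.

Fact fpsmulA : associative fpsmul.
Proof.
move=> f g h; apply: fpsP => n.
suff E a b c : fpscoef (fpsmul a (fpsmul b c)) n =
    (trunc n.+1 a * (trunc n.+1 b * trunc n.+1 c))`_n.
  by rewrite E fpsmulC E mulrA mulrC.
rewrite coefM; apply: eq_bigr => i _.
by rewrite coef_trunc // (@fpsmul_trunc n.+1) // ltnS leq_subr.
Qed.

Fact fpsmul1 : left_id (fpsC 1) fpsmul.
Proof.
move=> f; apply: fpsP => n /=.
by rewrite big_ord_recl /= mul1r subn0 big1 ?addr0 // => i _; rewrite mul0r.
Qed.

Fact fpsmulDl : left_distributive fpsmul fpsadd.
Proof.
move=> f g h; apply: fpsP => n /=; rewrite -big_split /=.
by apply: eq_bigr => i _; rewrite mulrDl.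
Qed.

Fact fps1_neq0 : fpsC 1 != 0.
Proof.
apply/eqP => /(congr1 (fun f => fpscoef f 0)) /= /eqP.
by rewrite oner_eq0.
Qed.

HB.instance Definition _ := GRing.Zmodule_isComNzRing.Build (fps R)
  fpsmulA fpsmulC fpsmul1 fpsmulDl fps1_neq0.

Lemma fpscoefM f g n :
  fpscoef (f * g) n = \sum_(i < n.+1) fpscoef f i * fpscoef g (n - i).
Proof. by []. Qed.

Lemma fps_invertible f (u : R) : fpscoef f 0 * u = 1 ->
  exists g, g * f = 1.
Proof.
move=> fu.
pose next (s : seq R) := - (\sum_(i < size s) fpscoef f i.+1 * s`_(size s - i.+1)) * u.
pose s := fix s n := if n is m.+1 then rcons (s m) (next (s m)) else [:: u].
have sz n : size (s n) = n.+1 by elim: n => //= n IH; rewrite size_rcons IH.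
have sE n m : (m <= n)%N -> (s n)`_m = (s m)`_m.
  elim: n => [|n IH]; first by rewrite leqn0 => /eqP ->.
  rewrite leq_eqVlt => /predU1P[-> //|mn].
  by rewrite /= nth_rcons sz mn IH // -ltnS.
exists (Fps (fun n => (s n)`_n)); rewrite mulrC; apply: fpsP => n.
rewrite fpscoefM big_ord_recl subn0.
case: n => [|n]; first by rewrite big_ord0 addr0.
rewrite /= nth_rcons sz ltnn eqxx /next sz mulrCA fu mulr1.
apply/eqP; rewrite addrC subr_eq0; apply/eqP; apply: eq_bigr => i _.
by rewrite /= subSS [in RHS]sE ?leq_subr.
Qed.

End FpsRing.

(* The localization R[1/s], for s not nilpotent *)
Section Localization.
Variables (R : comNzRingType) (s : R).
Hypothesis s_nnil : forall n, s ^+ n != 0.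

(* the pair (f, m) stands for f / s ^+ m *)
Definition loc_equiv (x y : R * nat) : bool :=
  `[< exists k, s ^+ k * (x.1 * s ^+ y.2) = s ^+ k * (y.1 * s ^+ x.2) >].

Fact loc_equiv_refl : reflexive loc_equiv.
Proof. by move=> x; apply/asboolP; exists 0. Qed.

Fact loc_equiv_sym : symmetric loc_equiv.
Proof. by move=> x y; apply/asboolP/asboolP => -[k E]; exists k. Qed.

Fact loc_equiv_trans : transitive loc_equiv.
Proof.
move=> [y m] [x n] [z p] /asboolP[/= k E] /asboolP[/= l E'].
apply/asboolP; exists (k + l + m)%N => /=; rewrite !exprD.
transitivity (s ^+ l * s ^+ p * (s ^+ k * (x * s ^+ m))); first by ring.
rewrite E.
transitivity (s ^+ k * s ^+ n * (s ^+ l * (y * s ^+ p))); first by ring.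
by rewrite E'; ring.
Qed.

Canonical loc_equiv_equiv :=
  EquivRel loc_equiv loc_equiv_refl loc_equiv_sym loc_equiv_trans.

Definition localization of (forall n, s ^+ n != 0) :=
  {eq_quot loc_equiv}%qT.
Local Notation loc := (localization s_nnil).

HB.instance Definition _ : EqQuotient _ loc_equiv loc := EqQuotient.on loc.
HB.instance Definition _ := Choice.on loc.

Let pi (f : R) (n : nat) : loc := (\pi_loc (f, n))%qT.

Let piP f m g n : (exists k, s ^+ k * (f * s ^+ n) = s ^+ k * (g * s ^+ m)) ->
  pi f m = pi g n.
Proof. by move=> E; apply/eqmodP/asboolP. Qed.

Let pi_eq f m g n : f * s ^+ n = g * s ^+ m -> pi f m = pi g n.
Proof. by move=> E; apply: piP; exists 0; rewrite E. Qed.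

Let pi_inj f m g n : pi f m = pi g n ->
  exists k, s ^+ k * (f * s ^+ n) = s ^+ k * (g * s ^+ m).
Proof. by move=> /eqmodP/asboolP. Qed.

Let num (a : loc) : R := (repr a).1.
Let den (a : loc) : nat := (repr a).2.
Let numden a : a = pi (num a) (den a).
Proof. by rewrite /pi /num /den -surjective_pairing reprK. Qed.

Definition loc_frac (f : R) (n : nat) : loc := pi f n.
Definition loc_opp a := pi (- num a) (den a).
Definition loc_add a b :=
  pi (num a * s ^+ den b + num b * s ^+ den a) (den a + den b).
Definition loc_mul a b := pi (num a * num b) (den a + den b).

Let oppE f m : loc_opp (pi f m) = pi (- f) m.
Proof.
have /pi_inj[k E] := numden (pi f m).
by apply: piP; exists k; rewrite !mulNr !mulrN E.
Qed.

Let addE f m g n : loc_add (pi f m) (pi g n) = pi (f * s ^+ n + g * s ^+ m) (m + n).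
Proof.
rewrite /loc_add; have /pi_inj[k E] := numden (pi f m); have /pi_inj[l E'] := numden (pi g n).
move: (num (pi f m)) (den (pi f m)) (num (pi g n)) (den (pi g n)) E E'.
move=> f' m' g' n' E E'.
apply: piP; exists (k + l)%N; rewrite !exprD.
transitivity (s ^+ l * s ^+ n * s ^+ n' * (s ^+ k * (f' * s ^+ m))
   + s ^+ k * s ^+ m * s ^+ m' * (s ^+ l * (g' * s ^+ n))); first by ring.
by rewrite -E -E'; ring.
Qed.

Let mulE f m g n : loc_mul (pi f m) (pi g n) = pi (f * g) (m + n).
Proof.
rewrite /loc_mul; have /pi_inj[k E] := numden (pi f m); have /pi_inj[l E'] := numden (pi g n).
move: (num (pi f m)) (den (pi f m)) (num (pi g n)) (den (pi g n)) E E'.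
move=> f' m' g' n' E E'.
apply: piP; exists (k + l)%N; rewrite !exprD.
transitivity ((s ^+ k * (f' * s ^+ m)) * (s ^+ l * (g' * s ^+ n)));
  first by ring.
by rewrite -E -E'; ring.
Qed.

Let pi_ind (P : loc -> Prop) : (forall f n, P (pi f n)) -> forall a, P a.
Proof. by move=> Ppi a; rewrite [a]numden. Qed.

Fact loc_addA : associative loc_add.
Proof.
elim/pi_ind => f m; elim/pi_ind => g n; elim/pi_ind => h p.
by rewrite !addE; apply: pi_eq; rewrite !exprD; ring.
Qed.
Fact loc_addC : commutative loc_add.
Proof.
elim/pi_ind => f m; elim/pi_ind => g n.
by rewrite !addE; apply: pi_eq; rewrite !exprD; ring.
Qed.
Fact loc_add0 : left_id (loc_frac 0 0) loc_add.
Proof. by elim/pi_ind => f m; rewrite addE; apply: pi_eq; ring. Qed.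
Fact loc_addN : left_inverse (loc_frac 0 0) loc_opp loc_add.
Proof. by elim/pi_ind => f m; rewrite oppE addE; apply: pi_eq; ring. Qed.

HB.instance Definition _ :=
  GRing.isZmodule.Build loc loc_addA loc_addC loc_add0 loc_addN.

Fact loc_mulA : associative loc_mul.
Proof.
elim/pi_ind => f m; elim/pi_ind => g n; elim/pi_ind => h p.
by rewrite !mulE; apply: pi_eq; rewrite !exprD; ring.
Qed.
Fact loc_mulC : commutative loc_mul.
Proof.
elim/pi_ind => f m; elim/pi_ind => g n.
by rewrite !mulE; apply: pi_eq; rewrite !exprD; ring.
Qed.
Fact loc_mul1 : left_id (loc_frac 1 0) loc_mul.
Proof. by elim/pi_ind => f m; rewrite mulE; apply: pi_eq; ring. Qed.
Fact loc_mulDl : left_distributive loc_mul loc_add.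
Proof.
elim/pi_ind => f m; elim/pi_ind => g n; elim/pi_ind => h p.
by rewrite !(mulE, addE); apply: pi_eq; rewrite !exprD; ring.
Qed.
Fact loc1_neq0 : loc_frac 1 0 != loc_frac 0 0.
Proof.
apply/eqP => /pi_inj[k /eqP].
by rewrite !expr0 mul0r !mulr1 mulr0 (negPf (s_nnil k)).
Qed.

HB.instance Definition _ := GRing.Zmodule_isComNzRing.Build loc
  loc_mulA loc_mulC loc_mul1 loc_mulDl loc1_neq0.

Definition loc_unit : pred loc := fun a => `[< exists b, b * a = 1 >].
Definition loc_inv (a : loc) : loc :=
  if pselect (exists b, b * a = 1) is left ab then projT1 (cid ab) else a.

Fact loc_mulV : {in loc_unit, left_inverse 1 loc_inv *%R}.
Proof.
move=> a /asboolP ab; rewrite /loc_inv; case: pselect => // {}ab.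
by case: (cid ab).
Qed.
Fact loc_unitP a b : b * a = 1 -> loc_unit a.
Proof. by move=> ba; apply/asboolP; exists b. Qed.
Fact loc_inv_out : {in [predC loc_unit], loc_inv =1 id}.
Proof.
move=> a /negP; rewrite /loc_inv; case: pselect => // ab [].
by apply/asboolP.
Qed.

HB.instance Definition _ := GRing.ComNzRing_hasMulInverse.Build loc
  loc_mulV loc_unitP loc_inv_out.

Definition to_loc (f : R) : loc := loc_frac f 0.

Fact to_loc_zmod_morphism : zmod_morphism to_loc.
Proof.
move=> f g; rewrite (oppE g 0 : - to_loc g = _) [RHS]addE; apply: pi_eq.
by rewrite !expr0; ring.
Qed.
Fact to_loc_monoid_morphism : monoid_morphism to_loc.
Proof. by split=> // f g; rewrite [RHS]mulE. Qed.

HB.instance Definition _ :=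
  GRing.isZmodMorphism.Build R loc to_loc to_loc_zmod_morphism.
HB.instance Definition _ :=
  GRing.isMonoidMorphism.Build R loc to_loc to_loc_monoid_morphism.

Lemma loc_frac_unit f g : g * f = 1 -> to_loc f \is a GRing.unit.
Proof.
move=> gf; apply: (@loc_unitP _ (loc_frac g 0)).
by rewrite [LHS]mulE gf.
Qed.

Lemma loc_s_unit : to_loc s \is a GRing.unit.
Proof.
apply: (@loc_unitP _ (loc_frac 1 1)).
by rewrite [LHS]mulE; apply: pi_eq; ring.
Qed.

End Localization.

Definition beta_index : choiceType := {kl : nat * nat | kl != (0, 0)%N}.

Definition base_ring : comNzRingType := {malg int[{cmonom beta_index}]}.

Definition beta (i : beta_index) : base_ring := << ucm i >>.

(* coefficient of x^k y^l in p(x, y) *)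
Definition p_coef (k l : nat) : base_ring :=
  if insub (k, l) is Some i then beta i else 1.

(* k[[x1, x2]] is realized as k[[x1]][[x2]] *)
Definition series2 : comNzRingType := fps (fps base_ring).

(* the series whose coefficient at x1^m x2^n is a m n *)
Definition Series2 (a : nat -> nat -> base_ring) : series2 :=
  Fps (fun n => Fps (fun m => a m n)).

Definition sx1 : series2 := fpsC (fpsX _).
Definition sx2 : series2 := fpsX _.
Definition sp12 : series2 := Series2 (fun m n => p_coef m n).
Definition sp21 : series2 := Series2 (fun m n => p_coef n m).

Lemma sx1Bsx2_nnil n : (sx1 - sx2) ^+ n != 0.
Proof.
suff E : fpscoef (fpscoef ((sx1 - sx2) ^+ n) 0) n = 1.
  by apply/eqP => E0; move: E; rewrite E0 => /esym/eqP; rewrite oner_eq0.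
elim: n => [//|n IH]; rewrite exprS fpscoefM big_ord1 subn0.
have -> : fpscoef (sx1 - sx2) 0 = fpsX _ by apply: fpsP => m /=; rewrite subr0.
rewrite fpscoefM 2!big_ord_recl big1 => [|i _]; last by rewrite /= mul0r.
by rewrite /= mul0r add0r addr0 mul1r subSS subn0 IH.
Qed.

Definition eval_ring : comUnitRingType := localization sx1Bsx2_nnil.

Definition x1 : eval_ring := to_loc sx1Bsx2_nnil sx1.
Definition x2 : eval_ring := to_loc sx1Bsx2_nnil sx2.
Definition p12 : eval_ring := to_loc sx1Bsx2_nnil sp12.
Definition p21 : eval_ring := to_loc sx1Bsx2_nnil sp21.

Lemma Series2_invertible a : a 0%N 0%N = 1 -> exists g, g * Series2 a = 1.
Proof.
move=> a00; have [u uE] : exists u, u * fpscoef (Series2 a) 0 = 1.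
  by apply: (@fps_invertible _ _ 1); rewrite mulr1.
by apply: (@fps_invertible _ _ u); rewrite mulrC.
Qed.

(* the negative powers below are powers of genuine inverses *)
Lemma p12_unit : p12 \is a GRing.unit.
Proof.
have [|g gE] := @Series2_invertible p_coef; last exact: loc_frac_unit gE.
by rewrite /p_coef insubN.
Qed.

Lemma p21_unit : p21 \is a GRing.unit.
Proof.
have [|g gE] := @Series2_invertible (fun m n => p_coef n m).
  by rewrite /p_coef insubN.
exact: loc_frac_unit gE.
Qed.

Lemma x1Bx2_unit : x1 - x2 \is a GRing.unit.
Proof. by rewrite -rmorphB; apply: loc_s_unit. Qed.

(* Pure two-dimensional simplicial complexes, given by their set T of triangles *)
Section Complex.
Variables (V : finType) (T : {set {set V}}).
Implicit Types (s e t : {set V}) (v : V).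

Definition star s : {set {set V}} := [set t in T | s \subset t].

Definition is_edge e : bool := (#|e| == 2%N) && (star e != set0).

(* the edges along which three sheets meet; they make up the singular circles *)
Definition singular : {set {set V}} :=
  [set e : {set V} | (#|e| == 2%N) && (#|star e| == 3%N)].

(* t and t' lie on both sides of a non-singular edge *)
Definition adjacent : rel {set V} := [rel t t' |
  [&& t \in T, t' \in T, #|t :&: t'| == 2%N & t :&: t' \notin singular]].

Definition adjacent_at v : rel {set V} :=
  [rel t t' | (v \in t :&: t') && adjacent t t'].

(* a facet, i.e. a component of the complement of the singular circles, is   *)
(* represented by the set of its triangles                                   *)
Definition facets : {set {set {set V}}} :=
  equivalence_partition (connect adjacent) T.

Definition singular_adjacent : rel {set V} := [rel e e' |
  [&& e \in singular, e' \in singular & e :&: e' != set0]].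

Definition singular_circles : {set {set {set V}}} :=
  equivalence_partition (connect singular_adjacent) singular.

(* Euler characteristic of the union of a set A of closed triangles *)
Definition euler_char (A : {set {set V}}) : int :=
  \sum_(s : {set V} | (s != set0) && [exists t in A, s \subset t])
     (-1) ^+ (#|s|.-1).

(* v has a neighbourhood which is a disk (its link is a circle), or an arc   *)
(* times a tripod (its link is a theta graph: the sheets at v are three      *)
(* half-disks, each bounded by the two singular edges at v)                  *)
Definition disk_at v : Prop :=
  [/\ forall e, e \in singular -> v \notin e
    & forall t t', t \in star [set v] -> t' \in star [set v] ->
        connect (adjacent_at v) t t'].

Definition tripod_at v : Prop :=
  #|[set e : {set V} in singular | v \in e]| = 2%N /\
  forall e t, e \in singular -> v \in e -> t \in star [set v] ->
    exists2 t', t' \in star e & connect (adjacent_at v) t t'.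

End Complex.

(* points of the geometric realization, in barycentric coordinates *)
Definition barycentric (R : realType) (V : finType) (T : {set {set V}})
    (l : {ffun V -> R}) : Prop :=
  [/\ forall v, 0 <= l v, \sum_v l v = 1
    & exists2 t, t \in T & forall v, v \notin t -> l v = 0].

Definition embedded (R : realType) (V : finType) (T : {set {set V}})
    (pos : V -> 'rV[R]_3) : Prop :=
  forall l m, barycentric T l -> barycentric T m ->
    \sum_v l v *: pos v = \sum_v m v *: pos v -> l = m.

(* A compact two-dimensional complex rectilinearly embedded in R^3, with     *)
(* tripod singularities along circles only. As a closed path around a        *)
(* singular circle preserves the cyclic order of the three sheets, and as    *)
(* only one of them is double in a foam, the neighbourhood of the whole      *)
(* circle is automatically the product of the circle and a tripod.           *)
Record foam_complex (R : realType) := FoamComplex {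
  vertex : finType;
  pos : vertex -> 'rV[R]_3;
  triangles : {set {set vertex}};
  card_triangle : forall t, t \in triangles -> #|t| = 3%N;
  pos_embedded : embedded triangles pos;
  card_star_edge : forall e, is_edge triangles e ->
    #|star triangles e| = 2%N \/ #|star triangles e| = 3%N;
  disk_or_tripod : forall v, disk_at triangles v \/ tripod_at triangles v
}.
Arguments pos {R K} : rename.

Definition facet (R : realType) (K : foam_complex R) : finType :=
  {f : {set {set vertex K}} | f \in facets (triangles K)}.

Definition in_facets (R : realType) (K : foam_complex R)
    (P : pred (facet K)) (t : {set vertex K}) : bool :=
  [exists f : facet K, P f && (t \in val f)].

(* The orientation of the facets is given by orientations of the triangles:  *)
(* orient a b c means that the triangle abc is oriented by its vertices in   *)
(* this cyclic order. The orientations of two triangles abc and abd agree    *)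
(* across the edge ab when they induce opposite directions on ab.            *)
Record bare_foam (R : realType) := BareFoam {
  fcomplex :> foam_complex R;
  thin : pred (facet fcomplex);
  thin_singular : forall e, e \in singular (triangles fcomplex) ->
    #|[set t in star (triangles fcomplex) e | in_facets thin t]| = 2%N;
  orient : vertex fcomplex -> vertex fcomplex -> vertex fcomplex -> bool;
  orient_rot : forall a b c, orient a b c = orient b c a;
  orient_triangle : forall a b c,
    [set a; b; c] \in triangles fcomplex -> orient a b c = ~~ orient b a c;
  orient_agree : forall a b c d, c != d ->
    [set a; b; c] \in triangles fcomplex ->
    [set a; b; d] \in triangles fcomplex ->
    [set a; b] \notin singular (triangles fcomplex) \/
      in_facets thin [set a; b; c] != in_facets thin [set a; b; d] ->
    orient a b c = orient b a d
}.
Arguments thin {R F} f : rename.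
Arguments orient {R F} : rename.

Record foam (R : realType) := Foam {
  bare :> bare_foam R;
  dots : facet bare -> nat;
  dots_thin : forall f, ~~ thin f -> dots f = 0%N
}.
Arguments dots {R F} f : rename.

Section RemoveDots.
Variables (R : realType) (F : foam R) (f : facet F) (n : nat).

Definition removed_dots (g : facet F) : nat :=
  if g == f then (dots g - n)%N else dots g.

Fact removed_dots_thin g : ~~ thin g -> removed_dots g = 0%N.
Proof. by rewrite /removed_dots => /dots_thin ->; case: ifP. Qed.

Definition remove_dots : foam R := Foam removed_dots_thin.

End RemoveDots.

Section Colorings.
Variables (R : realType) (F : bare_foam R).
Local Notation V := (vertex F).
Local Notation T := (triangles F).

Definition color1 : 'I_2 := ord0.
Definition color2 : 'I_2 := ord_max.

(* A thin facet colored i is given the set [set i], and a double facet the   *)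
(* set of both colors.                                                       *)
Definition coloring (c : {ffun facet F -> {set 'I_2}}) : bool :=
  [&& [forall f, thin f ==> (#|c f| == 1%N)],
      [forall f, ~~ thin f ==> (c f == setT)]
    & [forall e in singular T, forall t in star T e, forall t' in star T e,
        forall f : facet F, forall g : facet F,
        [&& t != t', thin f, thin g, t \in val f & t' \in val g] ==>
        (c f != c g)]].

Implicit Types (c : {ffun facet F -> {set 'I_2}}) (i : 'I_2).

(* the subcomplexes F_i(c) and F_12, as sets of triangles *)
Definition subsurface c i : {set {set V}} := \bigcup_(f | i \in c f) val f.
Definition thin_part : {set {set V}} := \bigcup_(f : facet F | thin f) val f.

Definition chi c i : int := euler_char (subsurface c i).

(* The determinant of the vectors ax, ay and ba: it is positive when, seen   *)
(* by an observer looking in the direction from a to b, the rotation about   *)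
(* ab from x to y with angle less than pi is counterclockwise.               *)
Definition turn (a b x y : V) : R :=
  \det (\matrix_(k < 3) nth 0 [:: pos x - pos a; pos y - pos a; pos a - pos b] k).

(* Looking from a to b, and rotating counterclockwise about ab starting from *)
(* d, one meets u before w. The angles between consecutive half-planes (d,   *)
(* then u, then w, then d) sum up to 2 pi, so that at least two of them are  *)
(* less than pi; in the opposite cyclic order, at least two of the           *)
(* determinants are negative.                                                *)
Definition ccw (a b d u w : V) : bool :=
  [|| (0 < turn a b d u) && (0 < turn a b u w),
      (0 < turn a b u w) && (0 < turn a b w d)
    | (0 < turn a b w d) && (0 < turn a b d u)].

(* The edge ab, directed from a to b as the boundary of the thin triangle    *)
(* abu (a vector pointing from this triangle into the double one, followed   *)
(* by b - a, is a positive basis for its orientation), is positive.          *)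
Definition positive_at c (a b : V) : bool :=
  [exists d, exists u, exists w,
    [&& [set a; b; d] \in T, [set a; b; u] \in T, [set a; b; w] \in T,
        u != w,
        ~~ in_facets thin [set a; b; d],
        in_facets thin [set a; b; u], in_facets thin [set a; b; w],
        orient a b u, ccw a b d u w
      & in_facets (fun f => c f == [set color1]) [set a; b; u]]].

Definition positive_circle c (C : {set {set V}}) : bool :=
  [exists a, exists b, ([set a; b] \in C) && positive_at c a b].

Definition theta_plus c : nat :=
  #|[set C in singular_circles T | positive_circle c C]|.

End Colorings.

(* An exact division in all cases where it is used: the closed surfaces      *)
(* F_1(c), F_2(c) and F_12 embed in R^3, hence are orientable and have even  *)
(* Euler characteristic.                                                     *)
Definition halfz (n : int) : int := (n %/ 2)%Z.

Section Evaluation.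
Variables (R : realType) (F : foam R).
Implicit Types (c : {ffun facet F -> {set 'I_2}}) (i : 'I_2).

Definition ndots c i : nat := (\sum_(f | c f == [set i]) dots f)%N.

Definition colored_eval c : eval_ring :=
  (-1) ^ ((theta_plus c)%:Z + halfz (chi c color2)) *
  (x1 ^+ ndots c color1 * x2 ^+ ndots c color2 *
   p12 ^ halfz (chi c color1) * p21 ^ halfz (chi c color2) /
   (x1 - x2) ^ halfz (euler_char (thin_part F))).

Definition foam_eval : eval_ring :=
  \sum_(c : {ffun facet F -> {set 'I_2}} | coloring c) colored_eval c.

End Evaluation.

Definition E1 : eval_ring := x1 + x2.
Definition E2 : eval_ring := x1 * x2.

(* Main.v *)
(* Each coloring gives the dotted thin facet one of the two colors, so that  *)
(* each of its dots contributes a factor x = x1 or x = x2 to the summand;    *)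
(* both are roots of x ^+ 2 = E1 * x - E2.                                   *)
Require Import Defs.
From mathcomp Require Import all_boot all_order all_algebra reals.
From mathcomp Require Import ring.
Import GRing.Theory.
Local Open Scope ring_scope.

(** The identity holds coloring by coloring. Dots do not affect the bare foam, so the three foams
    have the same colorings. If [x] is the variable of the color of [f] and [S] the summand of the
    foam with two dots removed, the three summands are [x ^+ 2 * S], [x * S] and [S]
    ([colored_eval_add_dots], [thin_color]). *)

Lemma ndots_add (R : realType) (B : bare_foam R) (d d' : facet B -> nat)
    (d_thin : forall g, ~~ thin g -> d g = 0%N)
    (d'_thin : forall g, ~~ thin g -> d' g = 0%N) (f : facet B) (n : nat)
    (c : {ffun facet B -> {set 'I_2}}) (i : 'I_2) :
    (forall g, d g = (g == f) * n + d' g)%N ->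
  @ndots R (Foam d_thin) c i =
    ((c f == [set i]) * n + @ndots R (Foam d'_thin) c i)%N.
Proof.
move=> dE; rewrite /ndots /= (eq_bigr _ (fun g _ => dE g)) big_split /=.
congr addn; case: (boolP (c f == [set i])) => [cf | cf].
  rewrite (bigD1 f cf) /= eqxx big1 ?addn0 // => g /andP[_ /negPf ->].
  by rewrite mul0n.
rewrite mul0n big1 // => g /eqP cg; case: eqP => [gf|]; last by rewrite mul0n.
by rewrite -gf cg eqxx in cf.
Qed.

(** Dots enter a summand only through the exponents [ndots]; the sign, the powers of [p12] and [p21]
    and the denominator depend on [B] and [c] alone. *)
Lemma colored_eval_add_dots (R : realType) (B : bare_foam R)
    (d d' : facet B -> nat)
    (d_thin : forall g, ~~ thin g -> d g = 0%N)
    (d'_thin : forall g, ~~ thin g -> d' g = 0%N) (f : facet B) (n : nat)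
    (c : {ffun facet B -> {set 'I_2}}) :
    (forall g, d g = (g == f) * n + d' g)%N ->
  @colored_eval R (Foam d_thin) c =
    x1 ^+ ((c f == [set color1]) * n) * x2 ^+ ((c f == [set color2]) * n) *
    @colored_eval R (Foam d'_thin) c.
Proof.
move=> dE.
rewrite /colored_eval !(ndots_add _ _ _ _ d_thin d'_thin _ _ _ _ dE) !exprD.
rewrite [_ * _ * (_ * _)]mulrACA -!mulrA mulrCA.
by rewrite [in LHS](mulrCA _ (x2 ^+ _)).
Qed.

(** Lets a single boolean decide both exponents in the theorem. *)
Lemma thin_color (R : realType) (F : bare_foam R) (f : facet F)
    (c : {ffun facet F -> {set 'I_2}}) : coloring c -> thin f ->
  (c f == [set color2]) = (c f != [set color1]).
Proof.
move=> /and3P[/forallP /(_ f) thin_c _ _] f_thin.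
move: thin_c; rewrite f_thin => /cards1P[i ->].
by rewrite !(inj_eq set1_inj); case: i => [[|[|]]].
Qed.

Theorem proposition4p10 (R : realType) (F2 : foam R) (f : facet F2)
    (f_thin : thin f) (f_dots : (2 <= dots f)%N) :
  foam_eval F2 =
    E1 * foam_eval (remove_dots f 1) - E2 * foam_eval (remove_dots f 2).
Proof.
case: F2 => B d d_thin in f f_thin f_dots *.
rewrite /foam_eval !mulr_sumr -sumrB; apply: eq_bigr => c col_c.
(* Both other summands are expressed through the one with two dots removed; [f_dots] keeps the
   truncated subtractions exact. *)
rewrite (@colored_eval_add_dots R B d _ d_thin
  (@removed_dots_thin R (Foam d_thin) f 2) f 2); last first.
  move=> g; rewrite /removed_dots; case: eqP => [->|_] //=.
  by rewrite mul1n subnKC.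
rewrite (@colored_eval_add_dots R B _ _
  (@removed_dots_thin R (Foam d_thin) f 1)
  (@removed_dots_thin R (Foam d_thin) f 2) f 1); last first.
  move=> g; rewrite /removed_dots; case: eqP => [->|_] //=.
  by rewrite mul1n add1n subnSK.
rewrite (thin_color _ _ _ _ col_c f_thin) /E1 /E2.
(* The cases are [x = x1] and [x = x2]. *)
by case: (c f == _) => /=; ring.
Qed.
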